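(* Let $G=(V,E,\mathrm{len})$ be a metric graph and suppose there exist a random connected metric tree $T$ and a random star-shaped mapping $F:V\to V(T)$ such that for some $K\ge1$, $$\max_{v\in V}\ \sup_{\tau>0}\ \mathbb E\,|\nabla_\tau F(v)|_\infty\le K.$$ Then for any family of functions $\{\ell_v:E(v)\to[0,\infty)\}_{v\in V}$ adapted to $\mathrm{len}$, and for any polymatroid capacities $\vec\rho=\{\rho_v\}_{v\in V}$ on $G$ and demands $\mathrm{dem}:V\times V\to[0,\infty)$, $$\Phi_G(\vec\rho,\mathrm{dem})\ \le\ \frac{64K\sum_{v\in V}\hat\rho_v(\ell_v)}{\sum_{u,v\in V}\mathrm{dem}(u,v)\cdot\mathbb E[d_T(F(u),F(v))]}.$$
   Context: Graphs are finite, undirected, without loops or parallel edges; $E(v)$ is the set of edges incident to $v$. A metric graph is a graph with non-negative edge lengths $\mathrm{len}:E\to[0,\infty)$; $d_G$ is its shortest-path pseudometric (zero distances between distinct vertices, and infinite distances when $G$ is disconnected, are allowed); lengths are assumed reduced, i.e. $\mathrm{len}(e)=d_G(u,v)$ for every edge $e=\{u,v\}$. A metric tree is a metric graph that is a tree, with shortest-path pseudometric $d_T$. A random map $F:V\to V(T)$ (with $T$ random) is a probability distribution over pairs (tree $T_\omega$, map $F_\omega:V\to V(T_\omega)$); a property asserted of $F$ or $T$ holds for every $\omega$. Single-scale gradient: for a map $f:V\to(X,d_X)$ and $\tau>0$, $|\nabla_\tau f(u)|_\infty=\sup\{d_X(f(u),f(v))/\mathrm{len}(u,v):\{u,v\}\in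 E,\ \mathrm{len}(u,v)\in[\tau,2\tau]\}$ (with $\sup\emptyset=0$). Star-shaped mapping: for a tree $T$ and $u,v\in V(T)$, let $P_{uv}\subseteq V(T)$ be the vertex set of the unique simple path from $u$ to $v$. A map $\lambda:V\to V(T)$ is star-shaped if for every $u\in V(T)$ the subgraph of $T$ induced on $\bigcup\{P_{uv}:v\in V(T),\ G\text{ has an edge between }\lambda^{-1}(u)\text{ and }\lambda^{-1}(v)\}$ is a (possibly degenerate) subdivision of a star centered at $u$; that is, the paths in $T$ that correspond to edges of $G$ and emanate from the same vertex $u$ of $T$ form a star-shaped subgraph. A family $\{\ell_v:E(v)\to[0,\infty)\}_{v\in V}$ is adapted to $\mathrm{len}$ if $\mathrm{len}(e)\le\ell_u(e)+\ell_v(e)$ for every edge $e=\{u,v\}$. Polymatroid capacities: a family $\vec\rho=\{\rho_v:2^{E(v)}\to[0,\infty)\}_{v\in V}$ of monotone submodular functions with $\rho_v(\emptyset)=0$. The Lovász extension is $\hat\rho_v(z)=\int_0^\infty\rho_v(\{e\in E(v):z_e\ge\theta\})\,d\theta$ for $z\in[0,\infty)^{E(v)}$. Demands are symmetric functions $V\times V\to[0,\infty)$. For $S\subseteq E$ let $\sigma_S(x,y)=0$ if there is a path from $x$ to $y$ in $(V,E\setminus S)$, and $\sigma_S(x,y)=1$ otherwise. A map $g:S\to V$ is valid if it maps every edge in $S$ to one of its two endpoints. Define $\nu_{\vec\rho}(S)=\min_{g:S\to V\text{ valid}}\sum_{v\in V}\rho_v(g^{-1}(v))$, $\Phi_G(S;\vec\rho,\mathrm{dem})=\nu_{\vec\rho}(S)/\sum_{u,v\in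 V}\mathrm{dem}(u,v)\sigma_S(u,v)$, and $\Phi_G(\vec\rho,\mathrm{dem})=\min_{S\subseteq E}\Phi_G(S;\vec\rho,\mathrm{dem})$. Ratios with zero denominator are interpreted as $+\infty$.
   Formalization: The formal theorem additionally assumes that E[d_T(F(u),F(v))] = 0 for every edge {u,v} of length 0; without it the claim fails (one edge of length 0 mapped to a tree edge of length 1). The distances d_T(F(u),F(v)) are also assumed measurable. *)

(* Defs.v *)
From HB Require Import structures.
From mathcomp Require Import all_boot all_order all_algebra.
From mathcomp Require Import all_classical all_reals all_analysis.
From mathcomp Require Import measurable_realfun.

Set Implicit Arguments.
Unset Strict Implicit.
Unset Printing Implicit Defensive.

Import Order.TTheory GRing.Theory Num.Theory.
Import numFieldNormedType.Exports.

Local Open Scope classical_set_scope.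
Local Open Scope ring_scope.

(* A simple graph on a finite vertex type V is given by its set E of edges, each
   edge being a two-element set of vertices; E is an arbitrary {set {set V}}
   until the record [metric_graph] imposes #|e| = 2 (so no loops). *)

Definition adj (V : finType) (E : {set {set V}}) : rel V :=
  [rel x y | [set x; y]%SET \in E].

Fixpoint walk_len (R : realType) (V : finType) (len : {set V} -> R)
    (x : V) (p : seq V) : R :=
  if p is y :: p' then len [set x; y]%SET + walk_len len y p' else 0.

(* The infimum of an empty set is +oo: distinct components are at distance +oo. *)
Definition spdist (R : realType) (V : finType) (E : {set {set V}})
    (len : {set V} -> R) (x y : V) : \bar R :=
  ereal_inf [set (walk_len len x p)%:E | p in
    [set p : seq V | path (adj E) x p /\ last x p = y]].

Record metric_graph (R : realType) := MetricGraph {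
  vertex :> finType;
  edges : {set {set vertex}};
  edge_len : {set vertex} -> R;
  card_edge : forall e, e \in edges -> #|e| = 2%N;
  edge_len_ge0 : forall e, e \in edges -> 0 <= edge_len e;
  edge_len_reduced : forall x y, adj edges x y ->
    (edge_len [set x; y]%SET)%:E = spdist edges edge_len x y
}.

Definition gdist (R : realType) (G : metric_graph R) (x y : G) : \bar R :=
  spdist (edges G) (@edge_len R G) x y.

Definition incident (R : realType) (G : metric_graph R) (v : G) :
    {set {set G}} := [set e in edges G | v \in e]%SET.

Definition is_tree (R : realType) (T : metric_graph R) : Prop :=
  (forall x y : T, connect (adj (edges T)) x y) /\
  (forall c : seq T, (2 < size c)%N -> ~~ ucycleb (adj (edges T)) c).

(* In a tree there is exactly one simple path from u to v, hence this is its
   vertex set. *)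
Definition tree_path (R : realType) (T : metric_graph R) (u v : T) : set T :=
  [set w | exists p : seq T,
    [/\ path (adj (edges T)) u p, last u p = v, uniq (u :: p) & w \in u :: p]].

(* The subgraph induced on W is a subdivision of a star centered at u: it
   consists of the paths u :: l, for l in legs, which meet only in u. Degenerate
   cases are allowed: no leg, one or two legs, and the empty subgraph. *)
Definition induces_star (R : realType) (T : metric_graph R) (u : T)
    (W : set T) : Prop :=
  W = set0 \/
  exists legs : seq (seq T),
    [/\ uniq (u :: flatten legs),
        W = [set w | w \in u :: flatten legs] &
        forall x y : T, W x -> W y ->
          (adj (edges T) x y <->
           exists2 l, l \in legs &
             infix [:: x; y] (u :: l) || infix [:: y; x] (u :: l))].

Definition star_shaped (R : realType) (G T : metric_graph R) (f : G -> T) :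
    Prop :=
  forall u : T, induces_star u
    (\bigcup_(v in [set v : T | exists x y : G,
                      [/\ adj (edges G) x y, f x = u & f y = v]])
       tree_path u v).

(* The terms are nonnegative, so starting the maximum at 0 only implements the
   convention that the supremum of the empty set is 0. *)
Definition gradient (R : realType) (G T : metric_graph R) (f : G -> T)
    (tau : R) (u : G) : \bar R :=
  (\big[maxe/0]_(v : G | adj (edges G) u v &&
                         (tau <= edge_len [set u; v]%SET <= 2 * tau)%R)
     (gdist (f u) (f v) / (edge_len [set u; v]%SET)%:E))%E.

Definition adapted (R : realType) (G : metric_graph R)
    (ell : G -> {set G} -> R) : Prop :=
  (forall v e, e \in incident v -> 0 <= ell v e) /\
  (forall x y : G, adj (edges G) x y ->
     edge_len [set x; y]%SET <= ell x [set x; y]%SET + ell y [set x; y]%SET).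

Definition polymatroid (R : realType) (G : metric_graph R)
    (rho : G -> {set {set G}} -> R) : Prop :=
  forall v : G,
    [/\ rho v finset.set0 = 0,
        forall A : {set {set G}}, A \subset incident v -> 0 <= rho v A,
        forall A B : {set {set G}}, A \subset B -> B \subset incident v ->
          rho v A <= rho v B &
        forall A B : {set {set G}}, A \subset incident v ->
          B \subset incident v ->
          rho v (A :|: B)%SET + rho v (A :&: B)%SET <= rho v A + rho v B].

Definition lovasz (R : realType) (G : metric_graph R)
    (rho : G -> {set {set G}} -> R) (v : G) (z : {set G} -> R) : \bar R :=
  (\int[@lebesgue_measure R]_(theta in `[0%R, +oo[)
     (rho v [set e in incident v | (theta <= z e)%R]%SET)%:E)%E.

Definition demand (R : realType) (V : Type) (dem : V -> V -> R) : Prop :=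
  (forall u v, 0 <= dem u v) /\ (forall u v, dem u v = dem v u).

Definition cut_sep (R : realType) (G : metric_graph R) (S : {set {set G}})
    (x y : G) : R :=
  (~~ connect (adj (edges G :\: S)%SET) x y)%:R.

Definition valid (V : finType) (S : {set {set V}})
    (g : {ffun {e : {set V} | e \in S} -> V}) : bool :=
  [forall e, g e \in val e].

Definition nu (R : realType) (G : metric_graph R)
    (rho : G -> {set {set G}} -> R) (S : {set {set G}}) : \bar R :=
  (\big[mine/+oo]_(g : {ffun {e : {set G} | e \in S} -> G} | valid g)
     (\sum_(v : G) rho v [set val e | e in g @^-1: [set v]]%SET)%:E)%E.

(* The library's x / y has 0 / 0 = 0 on \bar R (but +oo^-1 = 0 as needed). *)
Definition ediv (R : realType) (x y : \bar R) : \bar R :=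
  (if y == 0 then +oo else x / y)%E.

Definition Phi_cut (R : realType) (G : metric_graph R)
    (rho : G -> {set {set G}} -> R) (dem : G -> G -> R) (S : {set {set G}}) :
    \bar R :=
  ediv (nu rho S) (\sum_(u : G) \sum_(v : G) dem u v * cut_sep S u v)%:E.

Definition Phi (R : realType) (G : metric_graph R)
    (rho : G -> {set {set G}} -> R) (dem : G -> G -> R) : \bar R :=
  (\big[mine/+oo]_(S : {set {set G}} | S \subset edges G) Phi_cut rho dem S)%E.

(* Main.v *)
Require Import Defs.
From HB Require Import structures.
From mathcomp Require Import all_boot all_order all_algebra.
From mathcomp Require Import all_classical all_reals all_analysis.
From mathcomp Require Import measurable_realfun.
From mathcomp Require Import lra.

(* For a tree T_w, let h be the distance to a root and, for a level theta,
   cut every edge {x, y} of G such that F x and F y lie in different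
   components of T_w once the tree edges crossing level theta are removed.
   With m the median of the root, F u and F v, this cut separates u from v
   for all theta in ]h m, max (h (F u)) (h (F v))], an interval of length at
   least d(F u, F v) / 2. Charge each edge e to an endpoint v with len e <=
   2 ell_v e, and group edges by dyadic length scale: the edges of scale tau
   charged to v are met by the cut only if theta is within r of h (F v),
   where r <= 2 tau |grad_tau F(v)|. Integrating over theta and then over w,
   each scale costs at most a constant times K tau times the value of rho_v
   on its edges at v, and the sum over the scales of these terms is a
   Riemann sum bounded by the Lovasz extension. *)

Set Implicit Arguments.
Unset Strict Implicit.
Unset Printing Implicit Defensive.

Import Order.TTheory GRing.Theory Num.Theory.
Import numFieldNormedType.Exports.

Local Open Scope classical_set_scope.
Local Open Scope ring_scope.

(** * Walks and the shortest-path pseudometric *)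

Lemma adj_sym (V : finType) (E : {set {set V}}) : symmetric (adj E).
Proof. by move=> x y; rewrite /adj /= finset.setUC. Qed.

Lemma connect_adj_sym (V : finType) (E : {set {set V}}) :
  connect_sym (adj E).
Proof. exact/sym_connect_sym/adj_sym. Qed.

Lemma walk_len_cat (R : realType) (V : finType) (len : {set V} -> R) (x : V)
    (p q : seq V) :
  walk_len len x (p ++ q) = walk_len len x p + walk_len len (last x p) q.
Proof. by elim: p x => [|y p IH] x /=; rewrite ?add0r // IH addrA. Qed.

Lemma last_rev_belast (A : eqType) (x : A) (p : seq A) :
  last (last x p) (rev (belast x p)) = x.
Proof. by case: p => //= y p; rewrite rev_cons last_rcons. Qed.

Lemma walk_len_rev (R : realType) (V : finType) (len : {set V} -> R) (x : V)
    (p : seq V) :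
  walk_len len (last x p) (rev (belast x p)) = walk_len len x p.
Proof.
elim: p x => [|y p IH] x //=.
rewrite rev_cons -cats1 walk_len_cat IH /= last_rev_belast.
by rewrite addr0 addrC finset.setUC.
Qed.

Lemma path_adj_rev (V : finType) (E : {set {set V}}) (x : V) (p : seq V) :
  path (adj E) x p -> path (adj E) (last x p) (rev (belast x p)).
Proof. by rewrite rev_path; apply: sub_path => a b; rewrite adj_sym. Qed.

Lemma adj_neq (R : realType) (T : metric_graph R) (x y : T) :
  adj (edges T) x y -> x != y.
Proof. by move=> /card_edge; rewrite cards2; case: eqP. Qed.

Lemma walk_len_ge0 (R : realType) (T : metric_graph R) (x : T) (p : seq T) :
  path (adj (edges T)) x p -> 0 <= walk_len (@edge_len R T) x p.
Proof.
elim: p x => [|y p IH] x //= /andP[xy yp].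
by rewrite addr_ge0 ?IH // edge_len_ge0.
Qed.

(** Real-valued form of [gdist], meant for connected pairs: [fine] sends the infinite distance
    between two components to 0. *)
Definition dist (R : realType) (T : metric_graph R) (x y : T) : R :=
  fine (gdist x y).

Lemma gdist_ge0 (R : realType) (T : metric_graph R) (x y : T) :
  (0 <= gdist x y)%E.
Proof.
by apply: le_ereal_inf_tmp => _ [p [xp _] <-]; rewrite lee_fin walk_len_ge0.
Qed.

Lemma dist_ge0 (R : realType) (T : metric_graph R) (x y : T) : 0 <= dist x y.
Proof. by rewrite fine_ge0 // gdist_ge0. Qed.

Lemma gdist_le_walk (R : realType) (T : metric_graph R) (x : T) (p : seq T) :
  path (adj (edges T)) x p ->
  (gdist x (last x p) <= (walk_len (@edge_len R T) x p)%:E)%E.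
Proof. by move=> xp; apply: ereal_inf_lbound; exists p. Qed.

Lemma gdist_dist (R : realType) (T : metric_graph R) (x y : T) :
  connect (adj (edges T)) x y -> gdist x y = (dist x y)%:E.
Proof.
move=> /connectP[p xp ->]; rewrite fineK // ge0_fin_numE ?gdist_ge0 //.
by apply: le_lt_trans (gdist_le_walk xp) (ltry _).
Qed.

Lemma dist_le_walk (R : realType) (T : metric_graph R) (x : T) (p : seq T) :
  path (adj (edges T)) x p ->
  dist x (last x p) <= walk_len (@edge_len R T) x p.
Proof.
move=> xp; rewrite -lee_fin -gdist_dist ?gdist_le_walk //.
by apply/connectP; exists p.
Qed.

Lemma le_dist (R : realType) (T : metric_graph R) (x y : T) (c : R) :
  connect (adj (edges T)) x y ->
  (forall p, path (adj (edges T)) x p -> last x p = y ->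
     c <= walk_len (@edge_len R T) x p) ->
  c <= dist x y.
Proof.
move=> xy lec; rewrite -lee_fin -gdist_dist //.
by apply: le_ereal_inf_tmp => _ [p [xp py] <-]; rewrite lee_fin lec.
Qed.

Lemma dist_triangle (R : realType) (T : metric_graph R) (x y z : T) :
  connect (adj (edges T)) x y -> connect (adj (edges T)) y z ->
  dist x z <= dist x y + dist y z.
Proof.
move=> xy yz; rewrite -lerBlDr; apply: le_dist => // p xp py.
rewrite lerBlDl -lerBlDr; apply: le_dist => // q yq qz.
rewrite lerBlDr addrC -[y in walk_len _ y q]py -walk_len_cat.
rewrite -qz -[y in last y q]py -last_cat; apply: dist_le_walk.
by rewrite cat_path xp py.
Qed.

Lemma dist_sym (R : realType) (T : metric_graph R) (x y : T) :
  connect (adj (edges T)) x y -> dist x y = dist y x.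
Proof.
suff le a b : connect (adj (edges T)) a b -> dist b a <= dist a b.
  by move=> xy; apply/eqP; rewrite eq_le !le // connect_adj_sym.
move=> ab; apply: le_dist => // p ap <-.
rewrite -walk_len_rev -[a in dist _ a](last_rev_belast a p).
by apply/dist_le_walk/path_adj_rev.
Qed.

(** Each walk from [x] to [y] splits at [w] into two walks, whose lengths bound the two distances
    from above. *)
Lemma dist_via (R : realType) (T : metric_graph R) (x y w : T) :
  connect (adj (edges T)) x y ->
  (forall p, path (adj (edges T)) x p -> last x p = y -> w \in x :: p) ->
  dist x w + dist w y <= dist x y.
Proof.
move=> xy via; apply: le_dist => // p xp py.
have := via p xp py; rewrite inE => /orP[/eqP ->|wp].
  have := dist_le_walk xp; have := @dist_le_walk R T x [::] isT.
  by rewrite /= py; lra.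
case/splitPr: wp xp py => p1 p2; rewrite cat_path last_cat /=.
move=> /and3P[xp1 p1w wp2] p2y; rewrite -cat_rcons walk_len_cat last_rcons.
apply: lerD; last by rewrite -p2y dist_le_walk.
by rewrite -{1}(last_rcons x p1 w) dist_le_walk // rcons_path xp1.
Qed.

(** * Separation and medians in trees *)

(** A simple path joining [s] to [t] without the edge between them has at least three vertices, so
    the edge closes it to a forbidden cycle. *)
Lemma tree_bridge (R : realType) (T : metric_graph R) (s t : T) :
  is_tree T -> adj (edges T) s t ->
  ~~ connect (adj (edges T :\ [set s; t])%SET) s t.
Proof.
move=> [_ acyc] st; apply/negP => /connectP[p0 sp0 t0].
case: (shortenP sp0) t0 => p sp us _ tp {sp0 p0}.
have nst := adj_neq st.
have size2 : (2 < size (s :: p))%N.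
  case: p sp us tp => [|a [|b p]] //= sp _ tp.
    by rewrite tp eqxx in nst.
  by move: sp; rewrite -tp /adj /= !inE eqxx.
have /negP := acyc _ size2; apply; rewrite /ucycleb us andbT /=.
rewrite rcons_path -tp adj_sym st andbT.
by apply: sub_path sp => a b; rewrite /adj /= in_setD1 => /andP[].
Qed.

Lemma path_avoid (V : finType) (E : {set {set V}}) (x s t : V) (p : seq V) :
  t \notin x :: p -> path (adj E) x p ->
  connect (adj (E :\ [set s; t])%SET) x (last x p).
Proof.
move=> tp xp; apply/connectP; exists p => //.
elim: p x tp xp => //= y p IH x; rewrite inE negb_or => /andP[tx tp].
move=> /andP[xy yp]; rewrite IH // andbT /adj /= in_setD1.
rewrite [X in _ && X]xy andbT.
apply/eqP => /setP/(_ t); rewrite !inE eqxx orbT (negbTE tx) /=.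
by move: tp; rewrite inE negb_or => /andP[/negbTE ->].
Qed.

(** Suppose [q] misses [z], and let [s] precede [z] on [p]. Going from [s] back along [p] to [x],
    then along [q] to the common end, then back along [p] to [z] joins [s] to [z] without their
    edge, against [tree_bridge]. *)
Lemma tree_path_separates (R : realType) (T : metric_graph R) (x z : T)
    (p q : seq T) :
  is_tree T -> path (adj (edges T)) x p -> uniq (x :: p) -> z \in x :: p ->
  path (adj (edges T)) x q -> last x q = last x p -> z \in x :: q.
Proof.
move=> tree xp up zp xq qp; apply/negPn/negP => zq.
move: zp; rewrite inE => /orP[/eqP zx|zp].
  by rewrite zx inE eqxx in zq.
case/splitPr: zp xp up qp => p1 p2; rewrite cat_path last_cat /=.
move=> /and3P[xp1 sz zp2]; rewrite mem_cat negb_or cat_uniq /= => up qp.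
have zp1 : z \notin x :: p1.
  rewrite inE negb_or; move: up => /and3P[/andP[_ xz] up1].
  rewrite inE negb_or in xz; case/andP: xz => xz _.
  by rewrite eq_sym xz; move=> /and3P[]; rewrite negb_or => /andP[].
have sp2 : last x p1 \notin z :: p2.
  have := mem_last x p1; rewrite inE => /orP[/eqP ->|lp1].
    by case/and3P: up => /andP[].
  rewrite inE negb_or adj_neq //=; apply/negP => lp2.
  case/and3P: up => _ _ /and3P[/negP[]]; apply/orP; right.
  by apply/hasP; exists (last x p1).
have bridge := tree_bridge tree sz; apply/negP: bridge; rewrite negbK.
have c1 := path_avoid (last x p1) zp1 xp1.
have c2 := path_avoid (last x p1) zq xq.
have := path_avoid z sp2 zp2; rewrite finset.setUC => c3.
rewrite connect_adj_sym in c1; apply: connect_trans c1 _.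
by rewrite qp in c2; apply: connect_trans c2 _; rewrite connect_adj_sym.
Qed.

(** All walks are quantified over, not only the simple ones, so that the property applies directly
    to a walk in a subgraph. *)
Definition separates (R : realType) (T : metric_graph R) (w x y : T) : Prop :=
  forall p, path (adj (edges T)) x p -> last x p = y -> w \in x :: p.

(* The median of [a], [b], [c] is the first point of a path from [c] to [a] that
   lies on the simple path from [a] to [b]. *)
Lemma tree_median (R : realType) (T : metric_graph R) (a b c : T) :
  is_tree T ->
  exists w : T, [/\ separates w a b, separates w c a & separates w c b].
Proof.
move=> tree; have [conn _] := tree.
have [p0 ap0 b0] := connectP (conn a b).
case: (shortenP ap0) b0 => p ap up _ bp {ap0 p0}.
have [q0 cq0 a0] := connectP (conn c a).
case: (shortenP cq0) a0 => q cq uq _ aq {cq0 q0}.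
have sep_p w : w \in a :: p -> separates w a b.
  by move=> wp r ar rb; apply: tree_path_separates wp ar _; rewrite ?rb.
have [cp|cp] := boolP (c \in a :: p).
  exists c; split; first exact: sep_p.
    by move=> r _ _; rewrite mem_head.
  by move=> r _ _; rewrite mem_head.
have hasq : has (mem (a :: p)) q.
  apply/hasP; exists a; last by rewrite /= mem_head.
  have := mem_last c q; rewrite -aq inE => /orP[/eqP ac|//].
  by rewrite -ac mem_head in cp.
case: (split_find hasq) cq uq aq => w q1 q2 /= wp q1p.
rewrite cat_rcons cat_path last_cat /= => /and3P[cq1 q1w wq2] uq aq.
exists w; split; first exact: sep_p.
  move=> r cr ra; apply: (tree_path_separates tree _ uq _ cr).
  - by rewrite cat_path cq1 /= q1w.
  - by rewrite inE mem_cat mem_head !orbT.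
  - by rewrite ra last_cat.
(* [p2] is the part of [p] from [w] to [b]. As [q1] avoids [p], the concatenation of [q1], [w] and
   [p2] is a simple path from [c] to [b] through [w]. *)
have [p2 [wp2 up2 bp2 sub2]] : exists p2, [/\ path (adj (edges T)) w p2,
    uniq (w :: p2), b = last w p2 & {subset w :: p2 <= a :: p}].
  move: wp; rewrite inE => /orP[/eqP ->|wp]; first by exists p; split=> // z.
  case/splitPr: wp ap up bp q1p {sep_p cp} => p1 p2.
  rewrite cat_path last_cat -cat_cons cat_uniq /=.
  move=> /and3P[_ _ wp2] /and3P[_ _ up2] bp _; exists p2; split=> // z zp2.
  by rewrite inE mem_cat zp2 !orbT.
move=> r cr rb.
apply: (@tree_path_separates _ _ _ _ (q1 ++ w :: p2)) cr _ => //.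
- by rewrite cat_path cq1 /= q1w.
- rewrite -cat_cons cat_uniq up2 andbT; apply/andP; split.
    move: uq; rewrite cat_uniq mem_cat negb_or /=.
    by move=> /andP[/andP[-> _] /andP[->]].
  apply/hasPn => z /sub2 zp; rewrite /= inE negb_or; apply/andP; split.
    by apply: contraNneq cp => <-.
  by apply: contraNN q1p => zq1; apply/hasP; exists z.
- by rewrite inE mem_cat mem_head !orbT.
- by rewrite rb last_cat.
Qed.

(** * Cutting a tree at a distance from its root *)

(** These are the edges kept at level [theta], not the ones cut. Comparing all pairs of ends avoids
    orienting the edge. *)
Definition level_edges (R : realType) (T : metric_graph R) (r : T) (theta : R) :
    {set {set T}} :=
  [set e in edges T | [forall x in e, forall y in e,
     (theta <= dist r x) == (theta <= dist r y)]]%SET.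

Lemma adj_level_edges (R : realType) (T : metric_graph R) (r : T) (theta : R)
    (x y : T) :
  adj (level_edges r theta) x y =
  adj (edges T) x y && ((theta <= dist r x) == (theta <= dist r y)).
Proof.
rewrite /adj /= inE; congr (_ && _); apply/forall_inP/eqP => [H|xy a].
  have /forall_inP/(_ y) := H x (set21 x y).
  by rewrite set22 => /(_ isT)/eqP.
rewrite in_set2 => aE; apply/forall_inP => b; rewrite in_set2 => bE.
by case/orP: aE => /eqP ->; case/orP: bE => /eqP ->; rewrite ?xy.
Qed.

Lemma dist_lipschitz (R : realType) (T : metric_graph R) (r x y : T) :
  (forall a b : T, connect (adj (edges T)) a b) -> adj (edges T) x y ->
  `|dist r x - dist r y| <= edge_len [set x; y]%SET.
Proof.
move=> conn xy.
have xyp : path (adj (edges T)) x [:: y] by rewrite /= xy.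
have := dist_le_walk xyp; rewrite /= addr0 => le_xy.
have := dist_triangle (conn r x) (conn x y).
have := dist_triangle (conn r y) (conn y x).
by rewrite (dist_sym (conn y x)) ler_norml; lra.
Qed.

(** The distance to [r] is 1-Lipschitz along a walk, so a walk shorter than the gap between [x] and
    the level cannot cross the level. *)
Lemma connect_level_near (R : realType) (T : metric_graph R) (r x : T)
    (theta : R) (p : seq T) :
  (forall a b : T, connect (adj (edges T)) a b) -> path (adj (edges T)) x p ->
  walk_len (@edge_len R T) x p < `|theta - dist r x| ->
  connect (adj (level_edges r theta)) x (last x p).
Proof.
move=> conn; elim: p x => [|y p IH] x /=; first by rewrite connect0.
move=> /andP[xy yp] short.
have lip := dist_lipschitz r conn xy; have py := walk_len_ge0 yp.
apply: (@connect_trans _ _ y).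
  apply: connect1; rewrite adj_level_edges xy /=.
  move: short lip py; rewrite ler_norml.
  case: (leP theta (dist r x)); case: (leP theta (dist r y)) => // yt xt.
    by rewrite ler0_norm; lra.
  by rewrite ger0_norm; lra.
apply: IH => //; have := ler_distD (dist r y) theta (dist r x).
by rewrite (distrC (dist r y)); lra.
Qed.

Lemma level_cut_near (R : realType) (T : metric_graph R) (r x y : T)
    (theta : R) :
  (forall a b : T, connect (adj (edges T)) a b) ->
  ~~ connect (adj (level_edges r theta)) x y ->
  `|theta - dist r x| <= dist x y.
Proof.
move=> conn cut; apply: le_dist => // p xp py; rewrite leNgt.
by apply: contraNN cut => short; rewrite -py connect_level_near.
Qed.

(** With [w] the median of [r], [a], [b], take [m = dist r w] and [M] the larger of [dist r a] and
    [dist r b]. Since [w] separates [r] from both points, [dist a b] is at most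
    [(dist r a - m) + (dist r b - m)], hence at most [2 * (M - m)]. *)
Lemma level_cut_separates (R : realType) (T : metric_graph R) (r a b : T) :
  is_tree T ->
  exists m M : R, [/\ m <= M, dist a b <= 2 * (M - m) &
    forall theta, m < theta <= M ->
      ~~ connect (adj (level_edges r theta)) a b].
Proof.
move=> tree; have [conn _] := tree.
have [w [ab ra rb]] := tree_median a b r tree.
have wa := dist_via (conn r a) ra; have wb := dist_via (conn r b) rb.
have tri := dist_triangle (conn a w) (conn w b).
have da := dist_ge0 w a; have db := dist_ge0 w b.
rewrite (dist_sym (conn a w)) in tri.
exists (dist r w), (Num.max (dist r a) (dist r b)).
have ma : dist r a <= Num.max (dist r a) (dist r b) by rewrite le_max lexx.
have mb : dist r b <= Num.max (dist r a) (dist r b).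
  by rewrite le_max lexx orbT.
split; [lra|lra|move=> theta /andP[wt]; rewrite le_max => tab].
apply/negP => /connectP[p ap bp].
(* A walk along kept edges stays on one side of the level. It visits [w], which is below [theta],
   whereas [a] or [b] is not. *)
have same z : z \in a :: p -> (theta <= dist r z) = (theta <= dist r a).
  elim: p a ap {ab ra rb wa wb tri da db bp ma mb tab} => [|y p IH] a /=.
    by rewrite inE => _ /eqP ->.
  rewrite adj_level_edges => /andP[/andP[_ /eqP ay] yp].
  by rewrite inE => /orP[/eqP -> //|/(IH _ yp)]; rewrite ay.
have wp : w \in a :: p.
  apply: ab => //; apply: sub_path ap => x y.
  by rewrite adj_level_edges => /andP[].
have bin : b \in a :: p by rewrite bp mem_last.
by move: tab; rewrite (same b bin) orbb -(same w wp) leNgt wt.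
Qed.

(** * Pulling the level cuts back to [G] *)

Definition tree_cut (R : realType) (G T : metric_graph R) (f : G -> T) (r : T)
    (theta : R) : {set {set G}} :=
  [set e in edges G | ~~ [forall x in e, forall y in e,
     connect (adj (level_edges r theta)) (f x) (f y)]]%SET.

Lemma tree_cut_sub (R : realType) (G T : metric_graph R) (f : G -> T) (r : T)
    (theta : R) : tree_cut f r theta \subset edges G.
Proof. by apply/fintype.subsetP => e; rewrite inE => /andP[]. Qed.

(** An edge outside the cut has both ends mapped into one component, so a walk in [G] that avoids
    the cut has its image vertices in one component. *)
Lemma cut_sep_tree_cut (R : realType) (G T : metric_graph R) (f : G -> T)
    (r : T) (theta : R) (u v : G) :
  ~~ connect (adj (level_edges r theta)) (f u) (f v) ->
  cut_sep (tree_cut f r theta) u v = 1.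
Proof.
move=> sep; rewrite /cut_sep; suff -> : ~~ connect
  (adj (edges G :\: tree_cut f r theta)%SET) u v by [].
apply: contraNN sep => /connectP[p up ->].
elim: p u up => [|y p IH] u /=; first by rewrite connect0.
move=> /andP[uy yp]; apply: connect_trans (IH _ yp).
move: uy; rewrite /adj /= finset.in_setD inE => /andP[H uyE]; move: H.
rewrite uyE /= negbK => /forall_inP/(_ u); rewrite set21 => /(_ isT).
by move/forall_inP/(_ y); rewrite set22 => /(_ isT).
Qed.

Lemma tree_cut_near (R : realType) (G T : metric_graph R) (f : G -> T)
    (r : T) (theta : R) (v : G) (e : {set G}) :
  (forall a b : T, connect (adj (edges T)) a b) ->
  e \in tree_cut f r theta -> v \in e ->
  exists y, [/\ e = [set v; y]%SET, adj (edges G) v y &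
    `|theta - dist r (f v)| <= dist (f v) (f y)].
Proof.
move=> conn; rewrite inE => /andP[eE cut] ve.
have /eqP/cards2P[a [b [ab eab]]] := card_edge eE.
have [y evy] : exists y, e = [set v; y]%SET.
  move: ve; rewrite eab in_set2 => /orP[/eqP ->|/eqP ->]; first by exists b.
  by exists a; rewrite finset.setUC.
exists y; split; rewrite ?/adj /= -?evy //.
apply: level_cut_near => //; apply: contraNN cut => vy.
have yv : connect (adj (level_edges r theta)) (f y) (f v).
  by rewrite connect_adj_sym.
apply/forall_inP => p; rewrite evy in_set2 => pE.
apply/forall_inP => q; rewrite in_set2 => qE.
by case/orP: pE => /eqP ->; case/orP: qE => /eqP ->; rewrite ?connect0.
Qed.

(** * Charging the cut edges to vertices and scales *)

(** Submodularity gives subadditivity because [rho v] is nonnegative on intersections. *)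
Lemma polymatroid_bigcup (R : realType) (G : metric_graph R)
    (rho : G -> {set {set G}} -> R) (v : G) (I : Type) (s : seq I)
    (B : I -> {set {set G}}) :
  polymatroid rho -> (forall i, B i \subset incident v) ->
  rho v (\bigcup_(i <- s) B i)%SET <= \sum_(i <- s) rho v (B i).
Proof.
move=> /(_ v)[rho0 rho_ge0 _ sm] Bv.
(* The inclusion is carried through the induction because submodularity is available only below
   [incident v]. *)
suff [_ //] : (\bigcup_(i <- s) B i)%SET \subset incident v /\
  rho v (\bigcup_(i <- s) B i)%SET <= \sum_(i <- s) rho v (B i).
elim: s => [|i s [IHv IH]]; first by rewrite !big_nil rho0 finset.sub0set.
rewrite !big_cons finset.subUset Bv IHv; split=> //.
apply: le_trans (lerD (lexx _) IH); apply: le_trans (sm _ _ (Bv i) IHv).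
by rewrite lerDl rho_ge0 // (fintype.subset_trans _ (Bv i)) // finset.subsetIl.
Qed.

Lemma nu_le (R : realType) (G : metric_graph R)
    (rho : G -> {set {set G}} -> R) (S : {set {set G}}) (g : {set G} -> G) :
  (forall e, e \in S -> g e \in e) ->
  (nu rho S <= (\sum_(v : G) rho v [set e in S | g e == v]%SET)%:E)%E.
Proof.
move=> ge.
pose h : {ffun {e : {set G} | e \in S} -> G} := [ffun e => g (val e)].
have hv : valid h by apply/forallP => e; rewrite ffunE ge // (valP e).
rewrite /nu; apply: le_trans (bigmin_le_cond _ _ hv) _.
rewrite lee_fin le_eqVlt; apply/orP; left; apply/eqP.
apply: eq_bigr => v _; congr (rho v _); apply/setP => e.
apply/imsetP/idP => [[e' + ->]|].
  by rewrite !inE /h ffunE => ->; rewrite andbT (valP e').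
rewrite inE => /andP[eS gv]; exists (exist _ e eS) => //.
by rewrite !inE /h ffunE.
Qed.

(** The edges of scale [tau] that may be charged to [v]. Classes may overlap, both between scales
    and between the two ends of an edge; only covering matters. *)
Definition scale_class (R : realType) (G : metric_graph R)
    (ell : G -> {set G} -> R) (tau : R) (v : G) : {set {set G}} :=
  [set e in incident v | (tau <= edge_len e <= 2 * tau) &&
                         (edge_len e <= 2 * ell v e)]%SET.

(** An undivided form of the gradient, which still makes sense at [tau = 0]. *)
Definition scale_radius (R : realType) (G T : metric_graph R) (f : G -> T)
    (tau : R) (v : G) : R :=
  \big[Num.max/0]_(y : G | adj (edges G) v y &&
      (tau <= edge_len [set v; y]%SET <= 2 * tau)) dist (f v) (f y).

Lemma scale_class_sub (R : realType) (G : metric_graph R)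
    (ell : G -> {set G} -> R) (tau : R) (v : G) :
  scale_class ell tau v \subset incident v.
Proof. by apply/fintype.subsetP => e; rewrite inE => /andP[]. Qed.

(** The larger of the two values of [ell] on an edge is at least half of its length. The vertex [v0]
    is a default value outside the edge set. *)
Lemma adapted_endpoint (R : realType) (G : metric_graph R)
    (ell : G -> {set G} -> R) (v0 : G) :
  adapted ell -> exists g : {set G} -> G, forall e, e \in edges G ->
    g e \in e /\ edge_len e <= 2 * ell (g e) e.
Proof.
move=> [_ ad]; suff /choice[g gP] : forall e : {set G}, exists v : G,
  e \in edges G -> v \in e /\ edge_len e <= 2 * ell v e by exists g.
move=> e; have [eE|_] := boolP (e \in edges G); last by exists v0.
have /eqP/cards2P[a [b [_ eab]]] := card_edge eE.
have := ad a b; rewrite /adj /= -eab => /(_ eE) le_ab.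
have [la|lb] := leP (edge_len e) (2 * ell a e).
  by exists a => _; rewrite {1}eab set21.
by exists b => _; rewrite {1}eab set22; split=> //; lra.
Qed.

Lemma scale_radius_ge0 (R : realType) (G T : metric_graph R) (f : G -> T)
    (tau : R) (v : G) : 0 <= scale_radius f tau v.
Proof. exact: bigmax_ge_id. Qed.

(** The cut edges charged to [v] are covered by the traces of the cut on the scale classes at [v]. A
    trace is empty when [theta] is farther from [dist r (f v)] than the radius of its scale;
    otherwise monotonicity bounds its cost. *)
Lemma nu_tree_cut (R : realType) (G T : metric_graph R) (f : G -> T) (r : T)
    (theta : R) (ell : G -> {set G} -> R) (rho : G -> {set {set G}} -> R)
    (n : nat) (tau : nat -> R) (v0 : G) :
  (forall a b : T, connect (adj (edges T)) a b) ->
  adapted ell -> polymatroid rho ->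
  (forall e, e \in edges G ->
     exists i : 'I_n, tau i <= edge_len e <= 2 * tau i) ->
  (nu rho (tree_cut f r theta) <=
   (\sum_(v : G) \sum_(i < n) rho v (scale_class ell (tau i) v) *
      (`|theta - dist r (f v)| <= scale_radius f (tau i) v)%R%:R)%:E)%E.
Proof.
move=> conn ad poly cover; have [g gP] := adapted_endpoint v0 ad.
have SE e : e \in tree_cut f r theta -> e \in edges G.
  by apply/fintype.subsetP/tree_cut_sub.
apply: le_trans (nu_le _ (g := g) _) _ => [e /SE/gP[]//|].
rewrite lee_fin; apply: ler_sum => v _.
have [rho0 rho_ge0 mon sm] := poly v.
pose B (i : 'I_n) := (scale_class ell (tau i) v :&: tree_cut f r theta)%SET.
have Bv i : B i \subset incident v.
  exact: fintype.subset_trans (finset.subsetIl _ _) (scale_class_sub _ _ _).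
apply: (@le_trans _ _ (rho v (\bigcup_(i < n) B i)%SET)).
  apply: mon; last by apply/bigcupsP => i _.
  apply/fintype.subsetP => e; rewrite inE => /andP[eS /eqP ge].
  have [ve le_ell] := gP e (SE e eS); have [i le_i] := cover e (SE e eS).
  apply/bigcupP; exists i => //; rewrite finset.in_setI eS andbT !inE.
  by rewrite SE // le_i -ge ve.
apply: le_trans (polymatroid_bigcup _ poly Bv) _; apply: ler_sum => i _.
have [near|far] := boolP (_ <= scale_radius f (tau i) v).
  by rewrite mulr1 mon ?finset.subsetIl ?scale_class_sub.
rewrite mulr0 (_ : B i = finset.set0) ?rho0 //.
apply/setP => e; rewrite [RHS]finset.in_set0; apply/negP.
rewrite finset.in_setI => /andP[+ eS].
rewrite !inE => /andP[/andP[_ ve] /andP[le_i _]].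
have [y [evy vy le_vy]] := tree_cut_near conn eS ve.
apply/negP: far; rewrite negbK; apply: le_trans le_vy _.
by apply: (le_bigmax_cond _ (fun y => dist (f v) (f y))); rewrite vy -evy.
Qed.

(** * Averaging over the levels *)

Lemma integral_sum_indic (R : realType) (D : set R) (I : finType) (c l : I -> R)
    (A : I -> set R) :
  measurable D -> (forall i, 0 <= c i) -> (forall i, measurable (A i)) ->
  (forall i, A i `<=` D) ->
  (forall i, (@lebesgue_measure R) (A i) = (l i)%:E) ->
  (\int[@lebesgue_measure R]_(x in D) (\sum_i c i * \1_(A i) x)%:E =
   (\sum_i c i * l i)%:E)%E.
Proof.
move=> mD c0 mA AD lA.
under eq_integral do rewrite -sumEFin.
rewrite ge0_integral_sum //; last first.
- by move=> i x _; rewrite lee_fin mulr_ge0.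
- move=> i; apply/measurable_EFinP; apply: measurable_funM => //.
  by apply: measurable_indic; exact: mA.
rewrite -sumEFin; apply: eq_bigr => i _.
under eq_integral do rewrite EFinM.
rewrite ge0_integralZl_EFin //; last first.
  by apply/measurable_EFinP; apply: measurable_indic; exact: mA.
rewrite (integral_indic (@lebesgue_measure R) mD (mA i)).
by rewrite (setIidl (AD i)) EFinM; congr (_ * _)%E; exact: lA.
Qed.

Lemma measurable_sum_indic (R : realType) (D : set R) (I : finType) (c : I -> R)
    (A : I -> set R) :
  (forall i, measurable (A i)) ->
  measurable_fun D (fun x => (\sum_i c i * \1_(A i) x)%:E).
Proof.
move=> mA; apply/measurable_EFinP; apply: measurable_sum => i.
by apply: measurable_funM => //; exact: measurable_indic.
Qed.

(** Both sides are integrals over the line of the step functions compared in the last hypothesis. *)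
Lemma sum_indic_le_length (R : realType) (I J : finType) (c l : I -> R)
    (A : I -> set R) (c' l' : J -> R) (A' : J -> set R) :
  (forall i, 0 <= c i) -> (forall i, measurable (A i)) ->
  (forall i, (@lebesgue_measure R) (A i) = (l i)%:E) ->
  (forall j, 0 <= c' j) -> (forall j, measurable (A' j)) ->
  (forall j, (@lebesgue_measure R) (A' j) = (l' j)%:E) ->
  (forall x, \sum_i c i * \1_(A i) x <= \sum_j c' j * \1_(A' j) x) ->
  \sum_i c i * l i <= \sum_j c' j * l' j.
Proof.
move=> c0 mA lA c'0 mA' lA' le; rewrite -lee_fin.
rewrite -(integral_sum_indic measurableT c0 mA _ lA) //.
rewrite -(integral_sum_indic measurableT c'0 mA' _ lA') //.
apply: ge0_le_integral => //.
- by move=> x _; rewrite lee_fin sumr_ge0 // => i _; rewrite mulr_ge0.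
- exact: measurable_sum_indic.
- exact: measurable_sum_indic.
- by move=> x _; rewrite lee_fin.
Qed.

Lemma lebesgue_measure_itv_fin (R : realType) (a b : R) (s t : bool) : a <= b ->
  (@lebesgue_measure R) [set` Interval (BSide s a) (BSide t b)] = (b - a)%:E.
Proof.
rewrite le_eqVlt lebesgue_measure_itv /= lte_fin => /orP[/eqP ->|->] //.
by rewrite ltxx subrr.
Qed.

(** The estimate for one fixed tree, where [q] stands for any nonnegative lower bound on the cut
    ratios. The constant 4 is 2, from distance versus length of the separating interval, times 2,
    from a window of radius [r] having length [2 * r]. *)
Lemma tree_cut_average (R : realType) (G T : metric_graph R) (f : G -> T)
    (ell : G -> {set G} -> R) (rho : G -> {set {set G}} -> R)
    (dem : G -> G -> R) (n : nat) (tau : nat -> R) (q : R) :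
  is_tree T -> adapted ell -> polymatroid rho -> demand dem ->
  (forall e, e \in edges G ->
     exists i : 'I_n, tau i <= edge_len e <= 2 * tau i) ->
  0 <= q ->
  (forall S : {set {set G}}, S \subset edges G ->
     ((q * \sum_(u : G) \sum_(v : G) dem u v * cut_sep S u v)%:E
        <= nu rho S)%E) ->
  q * (\sum_(u : G) \sum_(v : G) dem u v * dist (f u) (f v)) <=
  4 * \sum_(v : G) \sum_(i < n)
    rho v (scale_class ell (tau i) v) * scale_radius f (tau i) v.
Proof.
move=> tree ad poly [dem0 _] cover q0 cut; have [conn _] := tree.
(* The root will be [f v0]; if [G] has no vertex, both sums are empty. *)
have [v0 _|G0] := pickP (@predT G); last by rewrite !big_pred0 // !mulr0.
have /choice[mM mMP] : forall p : G * G, exists mM : R * R,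
    [/\ mM.1 <= mM.2, dist (f p.1) (f p.2) <= 2 * (mM.2 - mM.1) &
      forall theta, mM.1 < theta <= mM.2 ->
        ~~ connect (adj (level_edges (f v0) theta)) (f p.1) (f p.2)].
  move=> p; have [m [M mMp]] := level_cut_separates (f v0) (f p.1) (f p.2) tree.
  by exists (m, M).
pose h v := dist (f v0) (f v).
pose r (p : G * 'I_n) := scale_radius f (tau p.2) p.1.
have r0 p : 0 <= r p by apply: scale_radius_ge0.
have rho0 v (A : {set {set G}}) : A \subset incident v -> 0 <= rho v A.
  by case: (poly v) => _ /(_ A).
pose A1 p := [set` `](mM p).1, (mM p).2]].
pose A2 p := [set` `[h p.1 - r p, h p.1 + r p]].
(* The separating intervals [A1] are weighted by demand and the windows [A2] by capacity; for each
   [theta] the cut [S] compares the two step functions. *)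
pose c1 (p : G * G) := q * dem p.1 p.2.
pose c2 (p : G * 'I_n) := rho p.1 (scale_class ell (tau p.2) p.1).
have le12 : \sum_p c1 p * ((mM p).2 - (mM p).1) <=
            \sum_p c2 p * ((h p.1 + r p) - (h p.1 - r p)).
  apply: (@sum_indic_le_length _ _ _ c1 _ A1 c2 _ A2).
  - by move=> p; rewrite mulr_ge0.
  - by move=> p; exact: measurable_itv.
  - by move=> p; rewrite lebesgue_measure_itv_fin //; case: (mMP p).
  - by move=> p; rewrite rho0 // scale_class_sub.
  - by move=> p; exact: measurable_itv.
  - by move=> p; rewrite lebesgue_measure_itv_fin //; have := r0 p; lra.
  move=> theta; pose S := tree_cut f (f v0) theta.
  apply: (@le_trans _ _
    (q * \sum_(u : G) \sum_(v : G) dem u v * cut_sep S u v)).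
    rewrite pair_bigA mulr_sumr; apply: ler_sum => p _.
    rewrite /c1 -mulrA ler_wpM2l // ler_wpM2l // indicE.
    have [|_] := boolP (theta \in A1 p); last by rewrite ler0n.
    rewrite inE /A1 /= in_itv /= => thp.
    by rewrite cut_sep_tree_cut //; case: (mMP p) => _ _; apply.
  rewrite -lee_fin; apply: le_trans (cut S (tree_cut_sub _ _ _)) _.
  apply: le_trans (nu_tree_cut f (f v0) theta v0 conn ad poly cover) _.
  rewrite lee_fin pair_bigA; apply: ler_sum => p _.
  rewrite ler_wpM2l ?rho0 ?scale_class_sub // indicE ler_nat.
  case: (boolP (`|_| <= _)) => // near; rewrite (_ : theta \in A2 p) //.
  rewrite inE /A2 /= in_itv /=; move: near; rewrite -/(h p.1) -/(r p).
  by rewrite ler_norml; lra.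
apply: (@le_trans _ _ (2 * \sum_p c1 p * ((mM p).2 - (mM p).1))).
  rewrite pair_bigA !mulr_sumr; apply: ler_sum => p _.
  have [_ le_p _] := mMP p.
  have := ler_wpM2l (mulr_ge0 q0 (dem0 p.1 p.2)) le_p.
  by rewrite /c1; lra.
rewrite pair_bigA [4 * _](_ : _ =
    2 * \sum_p c2 p * ((h p.1 + r p) - (h p.1 - r p))).
  by rewrite ler_pM2l.
by rewrite !mulr_sumr; apply: eq_bigr => p _; rewrite /c2 /r; lra.
Qed.

(** * Dyadic scales and the Lovász extension *)

(* The scale 0 carries the edges of length 0, which no positive scale sees. *)
Definition scale (R : realType) (t : R) (i : nat) : R :=
  if i is j.+1 then t * 2 ^+ j else 0.

Lemma scale_ge0 (R : realType) (t : R) (i : nat) : 0 < t -> 0 <= scale t i.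
Proof. by case: i => [|i] t0 //=; rewrite mulr_ge0 // ltW. Qed.

Lemma scale_lt (R : realType) (t : R) (i j : nat) : 0 < t -> (i < j)%N ->
  2 * scale t i <= scale t j.
Proof.
case: j => [|j] // t0; case: i => [|i] /= ij.
  by rewrite mulr0 mulr_ge0 // ltW.
by rewrite mulrCA -exprS ler_pM2l // ler_eXn2l // ltr1n.
Qed.

Lemma lovasz_integrand_nonincreasing (R : realType) (G : metric_graph R)
    (rho : G -> {set {set G}} -> R) (v : G) (z : {set G} -> R) :
  polymatroid rho ->
  nonincreasing_fun
    (fun theta : R => rho v [set e in incident v | (theta <= z e)%R]%SET).
Proof.
move=> /(_ v)[_ _ mon _] s t st; apply: mon.
  apply/fintype.subsetP => e; rewrite !inE => /andP[-> /=].
  exact: le_trans.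
by apply/fintype.subsetP => e; rewrite !inE => /andP[].
Qed.

Lemma measurable_lovasz_integrand (R : realType) (G : metric_graph R)
    (rho : G -> {set {set G}} -> R) (v : G) (z : {set G} -> R) (D : set R) :
  measurable D -> polymatroid rho ->
  measurable_fun D
    (fun theta => (rho v [set e in incident v | (theta <= z e)%R]%SET)%:E).
Proof.
move=> mD poly; apply/measurable_EFinP; apply: nonincreasing_measurable => //.
exact: lovasz_integrand_nonincreasing.
Qed.

(* The intervals ]scale t i / 4, scale t i / 2] are disjoint, and on the i-th
   one the integrand is at least rho v of the i-th scale class. *)
Lemma lovasz_ge (R : realType) (G : metric_graph R)
    (ell : G -> {set G} -> R) (rho : G -> {set {set G}} -> R) (v : G)
    (n : nat) (t : R) :
  polymatroid rho -> 0 < t ->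
  ((\sum_(i < n) rho v (scale_class ell (scale t i) v) * scale t i)%:E <=
   4%:E * lovasz rho v (ell v))%E.
Proof.
move=> poly t0; have [rho0 rho_ge0 mon _] := poly v.
pose c (i : 'I_n) := rho v (scale_class ell (scale t i) v).
pose A (i : 'I_n) := [set` `](scale t i / 4), (scale t i / 2)]].
have s0 i := scale_ge0 i t0.
have c0 i : 0 <= c i by rewrite rho_ge0 // scale_class_sub.
pose g theta := rho v [set e in incident v | (theta <= ell v e)%R]%SET.
have g0 theta : 0 <= g theta.
  by rewrite rho_ge0 //; apply/fintype.subsetP => e; rewrite !inE => /andP[].
have mA i : measurable (A i) by exact: measurable_itv.
have le_int : ((\sum_i c i * (scale t i / 2 - scale t i / 4))%:E <=
    lovasz rho v (ell v))%E.
  rewrite -(@integral_sum_indic _ `[0, +oo[ _ c _ A) //; first last.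
  - by move=> i; rewrite lebesgue_measure_itv_fin //; have := s0 i; lra.
  - move=> i x; rewrite /A /= !in_itv /= andbT; have := s0 i; lra.
  apply: ge0_le_integral => //.
  - by move=> x _; rewrite lee_fin sumr_ge0 // => i _; rewrite mulr_ge0.
  - exact: measurable_sum_indic.
  - exact: measurable_lovasz_integrand.
  move=> theta _; rewrite lee_fin.
  have [i Ai|noA] := pickP (fun i => theta \in A i); last first.
    by rewrite big1 ?g0 // => i _; rewrite indicE noA mulr0.
  rewrite (bigD1 i) //= big1 ?addr0.
    (* For an edge [e] of the class, [theta <= scale t i / 2 <= edge_len e / 2 <= ell v e]. *)
    rewrite indicE Ai mulr1; apply: mon.
      apply/fintype.subsetP => e; rewrite !inE => /andP[-> /=].
      by move: Ai; rewrite inE /A /= in_itv /=; lra.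
    by apply/fintype.subsetP => e; rewrite !inE => /andP[].
  move=> j ji; rewrite indicE (_ : _ \in A j = false) ?mulr0 //.
  apply/negbTE; move: Ai; rewrite !notin_setE !inE /A /= !in_itv /=.
  move=> /andP[i1 i2].
  move=> /andP[j1 j2].
  case: (ltngtP i j) => [ij|ij|/val_inj ij].
  - by have := scale_lt t0 ij; lra.
  - by have := scale_lt t0 ij; lra.
  - by rewrite ij eqxx in ji.
have := @lee_wpmul2l R 4%:E; rewrite lee_fin ler0n => /(_ isT _ _ le_int).
apply: le_trans; rewrite -EFinM lee_fin mulr_sumr.
by apply: ler_sum => i _; rewrite /c; lra.
Qed.

Lemma lovasz_ge0 (R : realType) (G : metric_graph R)
    (rho : G -> {set {set G}} -> R) (v : G) (z : {set G} -> R) :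
  polymatroid rho -> (0 <= lovasz rho v z)%E.
Proof.
move=> /(_ v)[_ rho_ge0 _ _]; apply: integral_ge0 => theta _.
rewrite lee_fin rho_ge0 //.
by apply/fintype.subsetP => e; rewrite !inE => /andP[].
Qed.

(** The integrand is at most [rho v (incident v)], and it vanishes beyond the largest value of [z]
    because the level set is then empty. *)
Lemma lovasz_fin (R : realType) (G : metric_graph R)
    (rho : G -> {set {set G}} -> R) (v : G) (z : {set G} -> R) :
  polymatroid rho -> (lovasz rho v z < +oo)%E.
Proof.
move=> poly; have [rho0 rho_ge0 mon _] := poly v.
pose M := \big[Num.max/0]_(e : {set G}) z e.
have M0 : 0 <= M by apply: bigmax_ge_id.
pose c (i : 'I_1) := rho v (incident v); pose A (i : 'I_1) := [set` `[0, M]].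
have sub theta :
    [set e in incident v | (theta <= z e)%R]%SET \subset incident v.
  by apply/fintype.subsetP => e; rewrite !inE => /andP[].
apply: (@le_lt_trans _ _ (\sum_i c i * (M - 0))%:E); last exact: ltry.
rewrite -(@integral_sum_indic _ `[0, +oo[ _ c _ A) //; first last.
- by move=> i; rewrite lebesgue_measure_itv_fin.
- by move=> i x; rewrite /A /= !in_itv /= andbT => /andP[].
- by move=> i; exact: measurable_itv.
- by move=> i; apply: rho_ge0.
apply: ge0_le_integral => //.
- by move=> x _; rewrite lee_fin rho_ge0.
- exact: measurable_lovasz_integrand.
- by apply: measurable_sum_indic => i; exact: measurable_itv.
move=> theta; rewrite /= in_itv /= andbT lee_fin big_ord1 indicE => th0.
have [thM|Mth] := leP theta M.
  rewrite (_ : theta \in A ord0) ?mulr1 ?mon //.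
  by rewrite inE /A /= in_itv /= th0.
rewrite (_ : [set e in _ | _]%SET = finset.set0) ?rho0 ?mulr_ge0 ?rho_ge0 //.
apply/setP => e; rewrite !inE; apply/negbTE/negP => /andP[_ le_e].
by have := le_lt_trans (le_trans le_e (le_bigmax _ z e)) Mth; rewrite ltxx.
Qed.

(** * Expectations over the random tree *)

Lemma scale_radius_EFin (R : realType) (G T : metric_graph R) (f : G -> T)
    (tau : R) (v : G) :
  (forall a b : T, connect (adj (edges T)) a b) ->
  (scale_radius f tau v)%:E =
  (\big[maxe/0]_(y : G | adj (edges G) v y &&
      (tau <= edge_len [set v; y]%SET <= 2 * tau)%R) gdist (f v) (f y))%E.
Proof.
move=> conn; rewrite (big_morph EFin (@EFin_max R) erefl).
by apply: eq_bigr => y _; rewrite gdist_dist.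
Qed.

Lemma measurable_bigmaxe (d : measure_display) (X : measurableType d)
    (R : realType) (I : finType) (Q : pred I) (g : I -> X -> \bar R) :
  (forall i, Q i -> measurable_fun [set: X] (g i)) ->
  measurable_fun [set: X] (fun x => \big[maxe/0%E]_(i | Q i) g i x).
Proof.
move=> mg; elim: (index_enum I) => [|i s IH].
  by under eq_fun do rewrite big_nil; exact: measurable_cst.
case Qi: (Q i); under eq_fun do rewrite big_cons Qi; last exact: IH.
by apply: measurable_maxe => //; exact: mg.
Qed.

(** For [tau > 0], an edge of the scale has length at most [2 * tau], so its image has length at
    most [2 * tau] times the gradient. For [tau = 0], the radius is at most the sum of the image
    lengths of the edges of length 0 at [v], each of zero expectation. *)
Lemma expectation_scale_radius (R : realType) (G : metric_graph R)
    (d : measure_display) (Omega : measurableType d) (P : probability Omega R)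
    (T : Omega -> metric_graph R) (F : forall w : Omega, G -> T w) (K tau : R)
    (v : G) :
  (forall w (a b : T w), connect (adj (edges (T w))) a b) ->
  (forall u v : G,
     measurable_fun [set: Omega] (fun w => gdist (F w u) (F w v))) ->
  (forall u v : G, adj (edges G) u v -> edge_len [set u; v]%SET = 0 ->
     (\int[P]_w gdist (F w u) (F w v) = 0)%E) ->
  (0 < tau -> (\int[P]_w gradient (F w) tau v <= K%:E)%E) ->
  0 <= tau ->
  (\int[P]_w (scale_radius (F w) tau v)%:E <= (2 * K * tau)%:E)%E.
Proof.
move=> conn mF F0 gradK; rewrite le_eqVlt => /orP[/eqP <-|tau0].
  rewrite mulr0; pose Q y := adj (edges G) v y &&
    ((0 : R) <= edge_len [set v; y]%SET <= 2 * 0).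
  pose g y w := if Q y then gdist (F w v) (F w y) else 0%E.
  have g0 y w : (0 <= g y w)%E by rewrite /g; case: (Q y); rewrite ?gdist_ge0.
  have mg y : measurable_fun [set: Omega] (g y) by rewrite /g; case: (Q y).
  apply: (@le_trans _ _ (\int[P]_w \sum_y g y w)%E).
    apply: ge0_le_integral => //.
    - by move=> w _; rewrite lee_fin scale_radius_ge0.
    - under eq_fun do rewrite scale_radius_EFin //.
      exact: measurable_bigmaxe.
    - exact: emeasurable_sum.
    move=> w _; rewrite scale_radius_EFin //.
    apply/bigmax_leP; split; first by apply: sume_ge0 => y _.
    move=> y Qy; rewrite (bigD1 y) //= {1}/g [Q y]Qy leeDl // sume_ge0 //.
  rewrite ge0_integral_sum // big1 // => y _; rewrite /g.
  case Qy: (Q y); last exact: integral0.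
  by case/andP: Qy => vy /andP[l0 l1]; apply: F0 => //; lra.
have mgrad : measurable_fun [set: Omega] (fun w => gradient (F w) tau v).
  apply: measurable_bigmaxe => y /andP[_ /andP[ty _]].
  rewrite inver gt_eqF ?(lt_le_trans tau0) //.
  exact: emeasurable_funM.
have grad0 w : (0 <= gradient (F w) tau v)%E by apply: bigmax_ge_id.
apply: (@le_trans _ _ (\int[P]_w ((2 * tau)%:E * gradient (F w) tau v))%E).
  apply: ge0_le_integral => //.
  - by move=> w _; rewrite lee_fin scale_radius_ge0.
  - under eq_fun do rewrite scale_radius_EFin //.
    exact: measurable_bigmaxe.
  - exact: emeasurable_funM.
  move=> w _; rewrite scale_radius_EFin //.
  apply/bigmax_leP; split.
    by rewrite mule_ge0 // lee_fin mulr_ge0 // ltW.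
  move=> y Qy; have /andP[vy /andP[l0 l1]] := Qy.
  have len0 : 0 < edge_len [set v; y]%SET by apply: lt_le_trans l0.
  apply: (@le_trans _ _ ((edge_len [set v; y]%SET)%:E *
    (gdist (F w v) (F w y) / (edge_len [set v; y]%SET)%:E)))%E.
    rewrite gdist_dist // inver gt_eqF // -!EFinM lee_fin.
    by rewrite mulrCA divff ?mulr1 // gt_eqF.
  apply: lee_pmul; rewrite ?lee_fin ?(ltW len0) //.
    rewrite gdist_dist // inver gt_eqF // -EFinM lee_fin.
    by rewrite divr_ge0 ?dist_ge0 // ltW.
  exact: (le_bigmax_cond _ (fun y => gdist (F w v) (F w y) /
    (edge_len [set v; y]%SET)%:E)%E).
rewrite ge0_integralZl_EFin ?mulr_ge0 //; last exact: ltW.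
rewrite (_ : 2 * K * tau = (2 * tau) * K); last lra.
by rewrite [leRHS]EFinM lee_wpmul2l ?gradK // lee_fin mulr_ge0 // ltW.
Qed.

Lemma scale_cover (R : realType) (G : metric_graph R) :
  exists (t : R) (n : nat), 0 < t /\ forall e, e \in edges G ->
    exists i : 'I_n, scale t i <= edge_len e <= 2 * scale t i.
Proof.
(* The unit is the least positive edge length, capped at 1 so that it is defined and positive even
   without such edges. *)
pose t : R := \big[Num.min/1]_(e in edges G | 0 < edge_len e) edge_len e.
have t0 : 0 < t by apply/bigmin_gtP; split=> // e /andP[].
have idx e : e \in edges G ->
    exists i, scale t i <= edge_len e <= 2 * scale t i.
  move=> eE; have := edge_len_ge0 eE; rewrite le_eqVlt => /orP[/eqP <-|e0].
    by exists 0%N; rewrite /= mulr0 lexx.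
  have te : t <= edge_len e by apply: bigmin_le_cond; rewrite eE.
  have ex : exists i, edge_len e < t * 2 ^+ i.
    exists (Num.truncn (edge_len e / t)).+1.
    rewrite mulrC -ltr_pdivrMr //; apply: lt_trans (truncnS_gt _) _.
    by rewrite -natrX ltr_nat ltn_expl.
  (* The least exponent [m] with [edge_len e < t * 2 ^+ m] is itself the index, since [scale] is
     shifted by one: [scale t m] is [t * 2 ^+ m.-1]. The case [m = 0] is excluded by [te]. *)
  exists (ex_minn ex); case: ex_minnP => -[|i].
    by rewrite expr0 mulr1 ltNge te.
  move=> lt_i min_i; rewrite /= mulrCA -exprS (ltW lt_i) andbT leNgt.
  by apply/negP => /min_i; rewrite ltnn.
have /choice[ix ixP] : forall e : {set G}, exists i, e \in edges G ->
    scale t i <= edge_len e <= 2 * scale t i.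
  move=> e; have [/idx[i ei]|_] := boolP (e \in edges G); first by exists i.
  by exists 0%N.
exists t, (\max_(e in edges G) ix e).+1; split=> // e eE.
have lt_e : (ix e < (\max_(e in edges G) ix e).+1)%N.
  by rewrite ltnS; apply: leq_bigmax_cond.
by exists (Ordinal lt_e); apply: ixP.
Qed.

Lemma measurable_scaled_double_sum (d : measure_display) (X : measurableType d)
    (R : realType) (I J : finType) (q : R) (c : I -> J -> R)
    (g : I -> J -> X -> \bar R) :
  (forall i j, measurable_fun [set: X] (g i j)) ->
  measurable_fun [set: X]
    (fun x => q%:E * \sum_i \sum_j (c i j)%:E * g i j x)%E.
Proof.
move=> mg; apply: emeasurable_funM => //.
by do 2![apply: emeasurable_sum => ?]; apply: emeasurable_funM.
Qed.

Lemma integral_scaled_double_sum (d : measure_display) (X : measurableType d)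
    (R : realType) (mu : {measure set X -> \bar R}) (I J : finType) (q : R)
    (c : I -> J -> R) (g : I -> J -> X -> \bar R) :
  0 <= q -> (forall i j, 0 <= c i j) -> (forall i j x, 0 <= g i j x)%E ->
  (forall i j, measurable_fun [set: X] (g i j)) ->
  (\int[mu]_x (q%:E * \sum_i \sum_j (c i j)%:E * g i j x) =
   q%:E * \sum_i \sum_j (c i j)%:E * \int[mu]_x g i j x)%E.
Proof.
move=> q0 c0 g0 mg.
have mcg i j : measurable_fun [set: X] (fun x => (c i j)%:E * g i j x)%E.
  exact: emeasurable_funM.
have cg0 i j x : (0 <= (c i j)%:E * g i j x)%E by rewrite mule_ge0 ?lee_fin.
rewrite ge0_integralZl_EFin //; last 2 first.
- by move=> x _; do 2![apply: sume_ge0 => ? _].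
- by do 2![apply: emeasurable_sum => ?].
congr (_ * _)%E; rewrite ge0_integral_sum //; last 2 first.
- by move=> i; apply: emeasurable_sum.
- by move=> i x _; apply: sume_ge0.
apply: eq_bigr => i _; rewrite ge0_integral_sum //; apply: eq_bigr => j _.
by rewrite ge0_integralZl_EFin.
Qed.

(** Integrates [tree_cut_average] over the random tree. The constant 32 is 4 from that lemma, times
    2 from the expected radius, times 4 from the comparison with the Lovász extension. *)
Lemma expected_demand_le (R : realType) (G : metric_graph R)
    (d : measure_display) (Omega : measurableType d) (P : probability Omega R)
    (T : Omega -> metric_graph R) (F : forall w : Omega, G -> T w) (K q : R)
    (ell : G -> {set G} -> R) (rho : G -> {set {set G}} -> R)
    (dem : G -> G -> R) :
  (forall w, is_tree (T w)) ->
  (forall u v : G,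
     measurable_fun [set: Omega] (fun w => gdist (F w u) (F w v))) ->
  (forall u v : G, adj (edges G) u v -> edge_len [set u; v]%SET = 0 ->
     (\int[P]_w gdist (F w u) (F w v) = 0)%E) ->
  0 <= K ->
  (forall (v : G) tau, 0 < tau -> (\int[P]_w gradient (F w) tau v <= K%:E)%E) ->
  adapted ell -> polymatroid rho -> demand dem -> 0 <= q ->
  (forall S : {set {set G}}, S \subset edges G ->
     ((q * \sum_(u : G) \sum_(v : G) dem u v * cut_sep S u v)%:E
        <= nu rho S)%E) ->
  (q%:E * \sum_(u : G) \sum_(v : G)
              (dem u v)%:E * \int[P]_w gdist (F w u) (F w v) <=
   (32 * K)%:E * \sum_(v : G) lovasz rho v (ell v))%E.
Proof.
move=> tree mF F0 K0 gradK ad poly demP q0 cut.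
have conn w (a b : T w) : connect (adj (edges (T w))) a b by case: (tree w).
have [t [n [t0 cover]]] := scale_cover G.
have [dem0 _] := demP.
have c0 (v : G) (i : 'I_n) : 0 <= rho v (scale_class ell (scale t i) v).
  by case: (poly v) => _ -> //; apply: scale_class_sub.
have mrad v i :
    measurable_fun [set: Omega]
      (fun w => (scale_radius (F w) (scale t i) v)%:E).
  under eq_fun do rewrite scale_radius_EFin //.
  exact: measurable_bigmaxe.
pose L w := (q%:E * \sum_(u : G) \sum_(v : G)
  (dem u v)%:E * gdist (F w u) (F w v))%E.
pose U w := (4%:E * \sum_(v : G) \sum_(i < n)
  (rho v (scale_class ell (scale t i) v))%:E *
  (scale_radius (F w) (scale t i) v)%:E)%E.
have LU : (\int[P]_w L w <= \int[P]_w U w)%E.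
  apply: ge0_le_integral => //.
  - move=> w _; rewrite mule_ge0 ?lee_fin //; do 2![apply: sume_ge0 => ? _].
    by rewrite mule_ge0 ?lee_fin ?gdist_ge0.
  - exact: measurable_scaled_double_sum.
  - exact: measurable_scaled_double_sum.
  move=> w _; have := tree_cut_average (F w) (tree w) ad poly demP cover q0 cut.
  rewrite -lee_fin !EFinM -!sumEFin => /le_trans le; apply: le_trans (le _ _).
    by rewrite lee_wpmul2l ?lee_fin //; apply: lee_sum => u _; rewrite -sumEFin;
      apply: lee_sum => v _; rewrite EFinM gdist_dist.
  rewrite lee_wpmul2l ?lee_fin //; apply: lee_sum => v _.
  by rewrite -sumEFin; apply: lee_sum => i _; rewrite EFinM.
move: LU; rewrite !integral_scaled_double_sum //; last 2 first.
- by move=> v i w; rewrite lee_fin scale_radius_ge0.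
- by move=> u v w; apply: gdist_ge0.
move=> /le_trans; apply.
rewrite (_ : (32 * K)%:E = 4%:E * (8 * K)%:E)%E; last first.
  by rewrite -EFinM; congr EFin; lra.
rewrite -muleA lee_wpmul2l ?lee_fin // ge0_sume_distrr; last first.
  by move=> v _; apply: lovasz_ge0.
apply: lee_sum => v _.
apply: (@le_trans _ _ ((2 * K)%:E *
    (\sum_(i < n) rho v (scale_class ell (scale t i) v) * scale t i)%:E)%E).
  rewrite -EFinM mulr_sumr -sumEFin; apply: lee_sum => i _.
  apply: le_trans (lee_wpmul2l _ (expectation_scale_radius conn mF F0
    (gradK v _) (scale_ge0 i t0))) _; first by rewrite lee_fin.
  by rewrite -EFinM lee_fin mulrCA.
apply: le_trans (lee_wpmul2l _ (lovasz_ge ell v n poly t0)) _.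
  by rewrite lee_fin mulr_ge0.
by rewrite muleA -EFinM (_ : 2 * K * 4 = 8 * K) //; lra.
Qed.

(** * From cut ratios to the final quotient *)

Lemma nu_ge0 (R : realType) (G : metric_graph R)
    (rho : G -> {set {set G}} -> R) (S : {set {set G}}) :
  polymatroid rho -> S \subset edges G -> (0 <= nu rho S)%E.
Proof.
move=> poly /fintype.subsetP SE; apply/bigmin_geP; split=> // g /forallP gv.
rewrite lee_fin sumr_ge0 // => v _; case: (poly v) => _ rho_ge0 _ _.
apply: rho_ge0; apply/fintype.subsetP => e /imsetP[e' + ->].
by rewrite !inE => /eqP <-; rewrite SE ?(valP e') //= gv.
Qed.

(** Clearing the denominator also covers the cuts that separate no demand: their ratio is [+oo] by
    convention, and the inequality reduces to [nu] being nonnegative. *)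
Lemma le_Phi_cut (R : realType) (G : metric_graph R)
    (rho : G -> {set {set G}} -> R) (dem : G -> G -> R) (q : R)
    (S : {set {set G}}) :
  polymatroid rho -> demand dem -> (q%:E <= Phi rho dem)%E ->
  S \subset edges G ->
  ((q * \sum_(u : G) \sum_(v : G) dem u v * cut_sep S u v)%:E <= nu rho S)%E.
Proof.
move=> poly [dem0 _] qPhi SE; set s := \sum_(u : G) _.
have s0 : 0 <= s.
  by do 2![apply: sumr_ge0 => ? _]; rewrite mulr_ge0 // ler0n.
have : (q%:E <= Phi_cut rho dem S)%E.
  by apply: le_trans qPhi _; apply: (bigmin_le_cond _ (Phi_cut rho dem)).
rewrite /Phi_cut /ediv -/s; case: ifPn => [/eqP[->] _|s_neq0].
  by rewrite mulr0 nu_ge0.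
have s_gt0 : 0 < s by rewrite lt_neqAle s0 eq_sym andbT.
by rewrite inver gt_eqF // lee_pdivlMr // -EFinM.
Qed.

(** [F_zero] controls the edges of length 0, on which the gradients at scales [tau > 0] give no
    information. *)
Theorem theorem1p7 (R : realType) (G : metric_graph R)
  (d : measure_display) (Omega : measurableType d) (P : probability Omega R)
  (T : Omega -> metric_graph R) (F : forall w : Omega, G -> T w)
  (K : R)
  (T_tree : forall w, is_tree (T w))
  (F_star : forall w, star_shaped (F w))
  (F_meas : forall u v : G,
     measurable_fun [set: Omega] (fun w => gdist (F w u) (F w v)))
  (F_zero : forall u v : G, adj (edges G) u v ->
     edge_len [set u; v]%SET = 0 ->
     (\int[P]_w gdist (F w u) (F w v) = 0)%E)
  (K_ge1 : 1 <= K)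
  (F_grad : forall v : G,
     (ereal_sup [set \int[P]_w gradient (F w) tau v | tau in
                   [set tau : R | (0 < tau)%R]] <= K%:E)%E)
  (ell : G -> {set G} -> R) (ell_adapted : adapted ell)
  (rho : G -> {set {set G}} -> R) (rho_polymatroid : polymatroid rho)
  (dem : G -> G -> R) (dem_demand : demand dem) :
  (Phi rho dem <=
     ediv ((64 * K)%:E * \sum_(v : G) lovasz rho v (ell v))
           (\sum_(u : G) \sum_(v : G)
              (dem u v)%:E * \int[P]_w gdist (F w u) (F w v)))%E.
Proof.
have gradK (v : G) tau : 0 < tau -> (\int[P]_w gradient (F w) tau v <= K%:E)%E.
  move=> tau0; apply: le_trans (F_grad v); apply: ereal_sup_ubound.
  by exists tau.
have K0 : 0 <= K by apply: le_trans K_ge1.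
set L := (\sum_(v : G) lovasz _ _ _)%E; set D := (\sum_(u : G) _)%E.
have D0 : (0 <= D)%E.
  do 2![apply: sume_ge0 => ? _]; rewrite mule_ge0 ?lee_fin //.
    by case: dem_demand.
  by apply: integral_ge0 => w _; apply: gdist_ge0.
have L0 : (0 <= L)%E by apply: sume_ge0 => v _; apply: lovasz_ge0.
have Lfin : L \is a fin_num.
  rewrite ge0_fin_numE //; apply: lte_sum_pinfty => v _; exact: lovasz_fin.
have KL0 : (0 <= (64 * K)%:E * L)%E by rewrite mule_ge0 // lee_fin mulr_ge0.
rewrite /ediv; case: ifPn => [_|D_neq0]; first exact: leey.
have quot0 : (0 <= (64 * K)%:E * L / D)%E by rewrite mule_ge0 // inve_ge0.
(* [Phi] can be [+oo], so the bound is proved for every finite [q] below it; if [Phi] is infinite,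
   the quotient then exceeds every real. *)
suff main q : 0 <= q -> (q%:E <= Phi rho dem)%E ->
    (q%:E <= (64 * K)%:E * L / D)%E.
  have [Phi0|Phi_lt0] := leP 0%E (Phi rho dem); last first.
    exact: le_trans (ltW Phi_lt0) quot0.
  case: (Phi rho dem) Phi0 main => [p p0 main|_ main|//].
    by apply: main; rewrite -?lee_fin.
  rewrite leye_eq; apply/eqP/eqyP => A A0; apply: main; rewrite ?leey //.
  exact: ltW.
move=> q0 qPhi.
have := expected_demand_le T_tree F_meas F_zero K0 gradK ell_adapted
  rho_polymatroid dem_demand q0
  (fun S => le_Phi_cut rho_polymatroid dem_demand qPhi).
rewrite -/D -/L => qD.
have D_gt0 : (0 < D)%E by rewrite lt_neqAle D0 eq_sym andbT.
move: (fineK Lfin) => LE; rewrite -LE in L0 KL0 quot0 qD *.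
have l0 : 0 <= fine L by rewrite -lee_fin.
have Kl0 : 0 <= K * fine L by rewrite mulr_ge0.
(* For finite [D] the factor 32 is relaxed to 64 after division. An infinite [D] is incompatible
   with [q > 0], because [q * D] would be [+oo] and yet bounded by a finite multiple of [L]. *)
case: D D0 D_neq0 D_gt0 qD quot0 => [r| |//] D0 D_neq0 D_gt0.
  move=> qD _; rewrite inver gt_eqF ?lee_pdivlMr -?lte_fin //.
  by apply: le_trans qD _; rewrite -!EFinM lee_fin; lra.
move: q0; rewrite le_eqVlt => /orP[/eqP <-|q0] qD quot0 //.
by move: qD; rewrite gt0_muley ?lte_fin // -EFinM leye_eq.
Qed.
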